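(* Let $(X,S)$ be a finite nondegenerate braided set. The rank of the derived structure group $A_X$ is equal to the number of equivalence classes in $X$ with respect to the equivalence relation $\backsim$, the smallest equivalence relation on $X$ such that $y\backsim\phi(y,x)$ for all $x,y\in X$.
   Context: Let $X$ be a nonempty set and $S:X\times X\to X\times X$ a bijection, written $S(x,y)=(g_x(y),f_y(x))$. $(X,S)$ is a braided set if $S_1S_2S_1=S_2S_1S_2$ on $X^3$, where $S_1=S\times \mathrm{id}$, $S_2=\mathrm{id}\times S$; it is nondegenerate if all maps $g_x$ and $f_y$ are bijections of $X$; it is finite if $X$ is finite. Write $x\circ y=g_x(y)$, $y*x=f_y^{-1}(x)$, $y^{-1}*x=f_y(x)$, and $\phi(y,x)=x^{-1}*((y*x)\circ y)$. The derived structure group $A_X$ is the group generated by the elements of $X$ with relations $x_1\bullet y=y_2\bullet x_1$ for $x,y\in X$, where $S(x,y)=(y_1,x_1)$, $S(y_1,x_1)=(x_2,y_2)$; equivalently, the relations are $\phi(y,x)\bullet x=x\bullet y$ for $x,y\in X$. The rank of a group $G$ having an abelian subgroup $\Gamma$ of finite index is defined as the rank of $\Gamma$ (this does not depend on the choice of $\Gamma$). When $X$ is finite, $A_X$ has an abelian subgroup of finite index. *)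

(* Defs.v *)
From HB Require Import structures.
From mathcomp Require Import all_boot order ssralg ssrnum ssrint boolp.

Set Implicit Arguments.
Unset Strict Implicit.
Unset Printing Implicit Defensive.

Import Order.TTheory GRing.Theory Num.Theory.

Local Open Scope quotient_scope.
Local Open Scope group_scope.

(* The letter (x, false) stands for the generator x, and (x, true) for its
   formal inverse. *)
Definition word (T : Type) := seq (T * bool).

Definition inv_letter (T : Type) (l : T * bool) : T * bool := (l.1, ~~ l.2).

Definition inv_word (T : Type) (w : word T) : word T :=
  rev (map (@inv_letter T) w).

Lemma inv_letterK (T : Type) : involutive (@inv_letter T).
Proof. by case=> x b; rewrite /inv_letter /= negbK. Qed.

Section PresentedGroup.
Variables (T : choiceType) (R : word T -> word T -> Prop).

Inductive pres_eq : word T -> word T -> Prop :=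
| pres_refl u : pres_eq u u
| pres_sym u v : pres_eq u v -> pres_eq v u
| pres_trans u v w : pres_eq u v -> pres_eq v w -> pres_eq u w
| pres_cat u u' v v' :
    pres_eq u u' -> pres_eq v v' -> pres_eq (u ++ v) (u' ++ v')
| pres_cancel l : pres_eq [:: inv_letter l; l] [::]
| pres_rel u v : R u v -> pres_eq u v.

Lemma pres_mulV w : pres_eq (inv_word w ++ w) [::].
Proof.
elim: w => [|l w IHw]; first exact: pres_refl.
rewrite /inv_word map_cons rev_cons cat_rcons.
apply: pres_trans IHw; rewrite -/(inv_word w).
apply: pres_cat; first exact: pres_refl.
exact: (pres_cat (pres_cancel l) (pres_refl w)).
Qed.

Lemma inv_wordK : involutive (@inv_word T).
Proof.
move=> w; rewrite /inv_word map_rev revK -map_comp -[RHS]map_id.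
by apply: eq_map => l /=; rewrite inv_letterK.
Qed.

Lemma pres_Vmul w : pres_eq (w ++ inv_word w) [::].
Proof. by have := pres_mulV (inv_word w); rewrite inv_wordK. Qed.

Lemma pres_inv u v : pres_eq u v -> pres_eq (inv_word u) (inv_word v).
Proof.
move=> uv; have cl := pres_cat (pres_refl (inv_word u)).
apply: (@pres_trans _ (inv_word u ++ (v ++ inv_word v))).
  by rewrite -[X in pres_eq X]cats0; apply/cl/pres_sym/pres_Vmul.
rewrite catA; apply: (pres_cat _ (pres_refl (inv_word v)) : pres_eq _ ([::] ++ _)).
apply: pres_trans (pres_mulV u); exact/cl/pres_sym.
Qed.

Definition pres_eqb : rel (word T) := fun u v => `[< pres_eq u v >].

Lemma pres_eqb_refl : reflexive pres_eqb.
Proof. by move=> u; apply/asboolP/pres_refl. Qed.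

Lemma pres_eqb_sym : symmetric pres_eqb.
Proof. by move=> u v; apply/asboolP/asboolP; apply: pres_sym. Qed.

Lemma pres_eqb_trans : transitive pres_eqb.
Proof.
by move=> v u w /asboolP uv /asboolP vw; apply/asboolP/(pres_trans uv vw).
Qed.

Canonical pres_equiv :=
  EquivRel pres_eqb pres_eqb_refl pres_eqb_sym pres_eqb_trans.

Definition presented_group := {eq_quot pres_equiv}.

HB.instance Definition _ := Choice.on presented_group.
HB.instance Definition _ := EqQuotient.on presented_group.

Implicit Types a b c : presented_group.

Definition pres_class (w : word T) : presented_group := \pi w.

Lemma pres_classP u v : pres_class u = pres_class v <-> pres_eq u v.
Proof.
by split=> [/eqmodP/asboolP|uv] //; apply/eqmodP/asboolP.
Qed.

Lemma pres_class_repr a : pres_class (repr a) = a.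
Proof. exact: reprK. Qed.

Lemma repr_pres_class w : pres_eq (repr (pres_class w)) w.
Proof. by apply/pres_classP; rewrite pres_class_repr. Qed.

Definition pres_one := pres_class [::].
Definition pres_mul a b := pres_class (repr a ++ repr b).
Definition pres_invg a := pres_class (inv_word (repr a)).

Lemma pres_mulE u v :
  pres_mul (pres_class u) (pres_class v) = pres_class (u ++ v).
Proof. by apply/pres_classP/pres_cat; apply: repr_pres_class. Qed.

Lemma pres_invE u : pres_invg (pres_class u) = pres_class (inv_word u).
Proof. by apply/pres_classP/pres_inv/repr_pres_class. Qed.

Lemma pres_mulA : associative pres_mul.
Proof.
move=> a b c; rewrite -[a]pres_class_repr -[b]pres_class_repr.
by rewrite -[c]pres_class_repr !pres_mulE catA.
Qed.

Lemma pres_mul1 : left_id pres_one pres_mul.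
Proof. by move=> a; rewrite -[a]pres_class_repr pres_mulE. Qed.

Lemma pres_mulr1 : right_id pres_one pres_mul.
Proof. by move=> a; rewrite -[a]pres_class_repr pres_mulE cats0. Qed.

Lemma pres_mulVg : left_inverse pres_one pres_invg pres_mul.
Proof.
move=> a; rewrite -[a]pres_class_repr pres_invE pres_mulE.
exact/pres_classP/pres_mulV.
Qed.

Lemma pres_mulgV : right_inverse pres_one pres_invg pres_mul.
Proof.
move=> a; rewrite -[a]pres_class_repr pres_invE pres_mulE.
exact/pres_classP/pres_Vmul.
Qed.

HB.instance Definition _ := isGroup.Build presented_group
  pres_mulA pres_mul1 pres_mulr1 pres_mulVg pres_mulgV.

Definition pres_gen (x : T) : presented_group := pres_class [:: (x, false)].

Lemma pres_classM u v : pres_class (u ++ v) = pres_class u * pres_class v.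
Proof. by rewrite -pres_mulE. Qed.

End PresentedGroup.

Definition eval_word (T : Type) (G : groupType) (f : T -> G) (w : word T) : G :=
  \prod_(l <- w) (if l.2 then (f l.1)^-1 else f l.1).

Lemma presented_group_univ (T : choiceType) (R : word T -> word T -> Prop)
    (G : groupType) (f : T -> G) :
  (forall u v, R u v -> eval_word f u = eval_word f v) ->
  exists! h : presented_group R -> G,
    {morph h : a b / a * b} /\ forall x, h (pres_gen R x) = f x.
Proof.
move=> fR; pose h (a : presented_group R) := eval_word f (repr a).
have ev_cat u v : eval_word f (u ++ v) = eval_word f u * eval_word f v.
  by rewrite /eval_word big_cat.
have ev1 l : eval_word f [:: l] = if l.2 then (f l.1)^-1 else f l.1.
  by rewrite /eval_word big_seq1.
have ev u v : pres_eq R u v -> eval_word f u = eval_word f v.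
  elim=> {u v} // [u v w _ -> _ ->|u u' v v' _ uu' _ vv'|[x b]] //.
    by rewrite !ev_cat uu' vv'.
  rewrite (ev_cat [:: _] [:: _]) !ev1 /eval_word big_nil.
  by case: b => /=; rewrite ?mulgV ?mulVg.
have hE w : h (pres_class R w) = eval_word f w by apply/ev/repr_pres_class.
have hM : {morph h : a b / a * b}.
  move=> a b; rewrite -[a]pres_class_repr -[b]pres_class_repr.
  by rewrite -pres_classM !hE ev_cat.
exists h; split; first by split=> // x; rewrite hE ev1.
move=> k [kM kE]; apply/funext => a; rewrite -[a]pres_class_repr.
have k1 : k 1 = 1 by apply: (@mulgI _ (k 1)); rewrite -kM !mulg1.
rewrite hE; elim: (repr a) => [|[x b] w IHw].
  by rewrite /eval_word big_nil -k1.
rewrite -cat1s ev_cat IHw pres_classM kM ev1; congr (_ * _).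
case: b => /=; last by rewrite -kE.
apply: (@mulgI _ (f x)); rewrite mulgV -[in RHS]kE -kM -pres_classM -k1.
congr k; apply/esym/pres_classP; exact: (pres_cancel R (x, true)).
Qed.

Definition expgz (G : groupType) (x : G) (k : int) : G :=
  match k with Posz n => x ^+ n | Negz n => x ^- n.+1 end.

Section Rank.
Variable G : groupType.
Implicit Types H K : {pred G}.

Definition abelian_subgroup H := group_closed H /\ {in H &, forall x y, commute x y}.

Definition finite_index H :=
  exists s : seq G, forall x, exists2 y, y \in s & y^-1 * x \in H.

Definition Z_independent n (a : 'I_n -> G) :=
  forall k : 'I_n -> int, \prod_(i < n) expgz (a i) (k i) = 1 ->
    forall i, k i = 0%R.

(* The rank of an abelian group is its rank as a Z-module: the largest size of
   a Z-linearly independent family. *)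
Definition abelian_rank H (r : nat) :=
  (exists2 a : 'I_r -> G, (forall i, a i \in H) & Z_independent a) /\
  (forall n (a : 'I_n -> G),
     (forall i, a i \in H) -> Z_independent a -> (n <= r)%N).

(* "G has an abelian subgroup of finite index, and its rank is r"; at most one r
   qualifies, whatever the subgroup: see group_rank_unique. *)
Definition group_rank (r : nat) :=
  exists H, [/\ abelian_subgroup H, finite_index H & abelian_rank H r].

End Rank.

Arguments group_rank : clear implicits.

Lemma expgzM (G : groupType) (x : G) (m : nat) (k : int) :
  expgz (x ^+ m) k = expgz x (Posz m * k)%R.
Proof.
case: k => n; first exact/esym/expgnA.
rewrite NegzE mulrN -[(Posz m * _)%R]/(Posz (m * n.+1)%N).
rewrite -NegzE [LHS]/= -expgnA.
by case: (m * n.+1)%N => [|p]; rewrite ?expg0 ?invg1 -?NegzE.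
Qed.

Lemma finite_index_pow (G : groupType) (K : {pred G}) (x : G) :
  group_closed K -> finite_index K -> exists m, x ^+ m.+1 \in K.
Proof.
move=> [K1 KF] [s sP].
have KV y : y \in K -> y^-1 \in K by move=> Ky; rewrite -[_^-1]mul1g KF.
have KM y z : y \in K -> z \in K -> y * z \in K.
  by move=> Ky /KV Kz; rewrite -[z]invgK KF.
have c_ex i : exists y, (y \in s) && (y^-1 * x ^+ i \in K).
  by have [y sy Ky] := sP (x ^+ i); exists y; rewrite sy.
have c_s i : xchoose (c_ex i) \in s by have /andP[] := xchooseP (c_ex i).
have c_lt i : (index (xchoose (c_ex i)) s < size s)%N by rewrite index_mem.
pose c (i : 'I_(size s).+1) : 'I_(size s) := Ordinal (c_lt i).
have [i [j [ij cij]]] : exists i j : 'I_(size s).+1, (i < j)%N /\ c i = c j.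
  have /injectivePn[i [j ij cij]] : ~~ injectiveb c.
    by apply/negP => /injectiveP/leq_card; rewrite !card_ord ltnn.
  case: (ltngtP i j) => [lt|lt|/val_inj e]; last by rewrite e eqxx in ij.
    by exists i, j.
  by exists j, i.
have /andP[_ Ki] := xchooseP (c_ex i); have /andP[_ Kj] := xchooseP (c_ex j).
move/(congr1 (nth 1 s \o val)): cij; rewrite /= !nth_index // => cij.
rewrite cij in Ki; move: (xchoose _) Ki Kj => y Ki Kj.
exists (j - i).-1; rewrite prednK ?subn_gt0 //.
have := KM _ _ (KV _ Ki) Kj.
have -> : x ^+ j = x ^+ i * x ^+ (j - i) by rewrite -expgnDr subnKC // ltnW.
by rewrite invgM invgK -mulgA mulVKg mulKg.
Qed.

Lemma group_rank_unique (G : groupType) (r s : nat) :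
  group_rank G r -> group_rank G s -> r = s.
Proof.
have le (H K : {pred G}) m n : abelian_rank H m -> abelian_rank K n ->
    group_closed K -> finite_index K -> (m <= n)%N.
  move=> [[a _ ind] _] [_ max] Kgr Kfi.
  have /choice[e eP] i := finite_index_pow (a i) Kgr Kfi.
  apply: (max _ (fun i => a i ^+ (e i).+1)) => // k prod1 i.
  have /(ind (fun i => Posz (e i).+1 * k i)%R)/(_ i)/eqP :
      \prod_(j < m) expgz (a j) (Posz (e j).+1 * k j)%R = 1.
    by rewrite -[RHS]prod1; apply: eq_bigr => j _; rewrite expgzM.
  by rewrite mulf_eq0 => /orP[]/eqP.
move=> [H [[Hg _] Hf Hr]] [K [[Kg _] Kf Kr]].
by apply/eqP; rewrite eqn_leq (le H K) // (le K H).
Qed.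

Section Braided.
Variables (X : Type) (S : X * X -> X * X).

(* S (x, y) = (g_x(y), f_y(x)) *)
Definition br_g (x y : X) : X := (S (x, y)).1.
Definition br_f (y x : X) : X := (S (x, y)).2.

Definition br_S1 (t : X * X * X) : X * X * X :=
  let: (x, y, z) := t in (S (x, y), z).

Definition br_S2 (t : X * X * X) : X * X * X :=
  let: (x, y, z) := t in let: (y', z') := S (y, z) in (x, y', z').

Definition braided := br_S1 \o br_S2 \o br_S1 =1 br_S2 \o br_S1 \o br_S2.

Definition nondegenerate :=
  (forall x, bijective (br_g x)) /\ (forall y, bijective (br_f y)).

Inductive derived_relation : word X -> word X -> Prop :=
| DerivedRelation x y y1 x1 x2 y2 :
    S (x, y) = (y1, x1) -> S (y1, x1) = (x2, y2) ->
    derived_relation [:: (x1, false); (y, false)] [:: (y2, false); (x1, false)].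

End Braided.

Definition derived_group (X : choiceType) (S : X * X -> X * X) : groupType :=
  presented_group (derived_relation S).

Section Phi.
Variables (X : finType) (S : X * X -> X * X).

Definition br_circ (x y : X) : X := br_g S x y.

(* y * x = f_y^-1(x); [finv h] is the inverse of h whenever h is injective. *)
Definition br_star (y x : X) : X := finv (br_f S y) x.
Definition br_starV (y x : X) : X := br_f S y x.

Definition br_phi (y x : X) : X := br_starV x (br_circ (br_star y x) y).

Definition phi_equiv : rel X := fun y z =>
  `[< forall E : rel X, equivalence_rel E ->
        (forall x y', E y' (br_phi y' x)) -> E y z >].

Lemma phi_equiv_equivalence : equivalence_rel phi_equiv.
Proof.
move=> x y z; split=> [|/asboolP xy]; first by apply/asboolP => E /(_ z z z)[].
apply/asboolP/asboolP => h E Eeq Ephi; have := h E Eeq Ephi;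
  by have [_ ->] := Eeq x y z; last exact: xy.
Qed.

Lemma derived_relation_phi (u v : word X) : nondegenerate S ->
  derived_relation S u v <->
  exists x y, u = [:: (x, false); (y, false)] /\
              v = [:: (br_phi y x, false); (x, false)].
Proof.
case=> _ fbij; have finj y := bij_inj (fbij y); split.
  case=> x y y1 x1 x2 y2 S1 S2; exists x1, y; split=> //.
  have x1E : br_f S y x = x1 by rewrite /br_f S1.
  rewrite /br_phi /br_star -[in finv _ _]x1E finv_f // /br_circ /br_g S1.
  by rewrite /br_starV /br_f S2.
move=> [x [y [-> ->]]]; have fx := f_finv (finj y) x.
have S1 : S (br_star y x, y) = (br_circ (br_star y x) y, x).
  by rewrite [LHS]surjective_pairing; congr (_, _); exact: fx.
by apply: (DerivedRelation S1); rewrite [LHS]surjective_pairing.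
Qed.

End Phi.

(* Main.v *)
Require Import Defs.
From mathcomp Require Import all_boot order ssralg ssrnum ssrint boolp.
From mathcomp Require Import poly zmodp matrix mxalgebra mxpoly rat.

Set Implicit Arguments.
Unset Strict Implicit.
Unset Printing Implicit Defensive.

Import Order.TTheory GRing.Theory Num.Theory.
Local Open Scope group_scope.

(** The relations of the derived structure group G say that conjugation by a
    generator permutes the images of the elements of X in G: x y x^-1 is the
    generator phi(y, x).  Everything follows from this finiteness.

    Put N = |X|!.  For generators x and y, the |X| + 1 conjugates
    x^i y x^-i with 0 <= i <= |X| are all generators, so two of them coincide
    and some power x^j with 0 < j <= |X| commutes with y; as j divides N, the
    power x^N is central ([gen_power_central]).  Since phi(y, x) is conjugate to
    y and the N-th powers are central, x^N depends only on the class of x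
    ([phi_equiv_power]).  Let H be the subgroup generated by these central
    elements z_c, one for each class c.

    H has finite index ([finite_index_powers], the argument of Dietzmann's
    lemma): modulo H every element is a product of generators without inverses,
    and in a product of more than |X| (N - 1) generators one of them, x, occurs
    at least N times; its occurrences can be moved to the front at the price of
    conjugating the other factors, and x^N is then absorbed by H.

    H is free abelian on the z_c ([int_span_rank]): for each class c, counting
    with sign the letters in c is invariant under the relations, hence is an
    additive map on G ([degreeM]); it takes the value N on z_c and 0 on the
    other z's.  So the degrees detect the exponents of an element of H, and the
    rank of H is the number of classes because more than r vectors in Z^r are
    linearly dependent ([int_dependence]). *)

(** * Integer powers and additive maps *)

Lemma int_diff (k : int) : exists m n : nat, k = (m%:Z - n%:Z)%R.
Proof.
case: k => n; first by exists n, 0%N; rewrite subr0.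
by exists 0%N, n.+1; rewrite sub0r NegzE.
Qed.

Lemma expgz_diff (G : groupType) (x : G) (m n : nat) :
  expgz x (m%:Z - n%:Z)%R = x ^+ m / x ^+ n.
Proof.
have [le_nm|lt_mn] := leqP n m; first by rewrite subzn //= expgnFr.
have le_mn := ltnW lt_mn.
rewrite -opprB subzn // -[in RHS](subnKC le_mn) expgnDr invgM mulgA.
rewrite -(prednK (_ : 0 < n - m)%N) ?subn_gt0 // -NegzE /=.
have c : commute (x ^+ m) (x ^- (n - m).-1.+1) by exact/commuteV/commuteX2.
by rewrite c mulgK.
Qed.

Lemma expgzB (G : groupType) (x : G) (k l : int) :
  expgz x (k - l)%R = expgz x k / expgz x l.
Proof.
have [[a [b ->]] [c [d ->]]] := (int_diff k, int_diff l).
rewrite opprB addrACA -opprD -!PoszD !expgz_diff !expgnDr.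
rewrite !invgM !invgK -!mulgA; congr (_ * _); rewrite mulgA.
by apply/commute_sym/commuteM; do ?apply: commuteV;
  apply/commute_sym; do ?apply: commuteV; apply: commuteX2.
Qed.

Lemma expgz_commute {G : groupType} {x y : G} (k : int) :
  commute x y -> commute x (expgz y k).
Proof. by move=> xy; case: k => n; [|apply: commuteV]; apply: commuteX. Qed.

Section AdditiveMaps.
Variables (G : groupType) (d : G -> int).
Hypothesis dM : forall a b, d (a * b) = (d a + d b)%R.

Lemma degree1 : d 1 = 0%R.
Proof. by apply: (@addrI _ (d 1)); rewrite -dM mulg1 addr0. Qed.

Lemma degree_expgz a k : d (expgz a k) = (k * d a)%R.
Proof.
have dX n : d (a ^+ n) = (n%:Z * d a)%R.
  elim: n => [|n IHn]; first by rewrite degree1 mul0r.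
  by rewrite expgS dM IHn intS mulrDl mul1r.
case: k => n /=; first exact: dX.
apply: (@addrI _ (d (a ^+ n.+1))).
by rewrite -dM mulgV degree1 dX NegzE mulNr subrr.
Qed.

Lemma degree_prod n (a : 'I_n -> G) (k : 'I_n -> int) :
  d (\prod_(i < n) expgz (a i) (k i)) = (\sum_(i < n) k i * d (a i))%R.
Proof.
rewrite (big_morph d dM degree1); apply: eq_bigr => i _; exact: degree_expgz.
Qed.

End AdditiveMaps.

(** A rational solution of the linear system exists by a dimension count;
    reading it as a polynomial gives its coordinates a common denominator. *)
Lemma int_dependence n r (A : 'I_n -> 'I_r -> int) : (r < n)%N ->
  exists2 k : 'I_n -> int, (exists i, k i != 0%R)
    & forall c, (\sum_(i < n) k i * A i c)%R = 0%R.
Proof.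
move=> lt_rn; pose M := (\matrix_(i, c) (A i c)%:~R : 'M[rat]_(n, r))%R.
have /rowV0Pn[v /sub_kermxP vM v0] : kermx M != 0%R.
  rewrite -mxrank_eq0 mxrank_ker subn_eq0 -ltnNge.
  exact: leq_ltn_trans (rank_leq_col M) lt_rn.
have [q [a a0 qE]] := rat_poly_scale (rVpoly v).
have vE i : v 0%R i = (a%:~R^-1 * (q`_i)%:~R)%R.
  by rewrite -coef_rVpoly_ord qE coefZ coef_map.
have a0' : (a%:~R : rat)%R != 0%R by rewrite intr_eq0.
exists (fun i => (q`_i)%R).
  have /rV0Pn[i vi] := v0; exists i; move: vi.
  by rewrite vE mulf_eq0 negb_or intr_eq0 => /andP[].
move=> c; apply/eqP; rewrite -(intr_eq0 rat) raddf_sum /=.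
move/matrixP/(_ 0%R c): vM; rewrite !mxE => /(congr1 ( *%R a%:~R))%R.
rewrite mulr0 mulr_sumr => vM; apply/eqP; rewrite -[RHS]vM.
by apply: eq_bigr => i _; rewrite vE mxE intrM !mulrA mulfV // mul1r.
Qed.

(** * Subgroups generated by finitely many central elements *)

Section Span.
Variables (G : groupType) (r : nat) (z : 'I_r -> G).
Hypothesis z_central : forall i g, commute g (z i).

(** As the z_i are central, these products form the subgroup that they
    generate. *)
Definition int_span : {pred G} := fun g =>
  `[< exists m : 'I_r -> int, g = \prod_(i < r) expgz (z i) (m i) >].

Lemma int_spanP g :
  reflect (exists m : 'I_r -> int, g = \prod_(i < r) expgz (z i) (m i))
          (g \in int_span).
Proof. exact: asboolP. Qed.

Lemma int_span_central g h : h \in int_span -> commute g h.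
Proof.
by move=> /int_spanP[m ->]; apply: commute_prod => i _; apply: expgz_commute.
Qed.

Lemma int_span_group : group_closed int_span.
Proof.
split=> [|_ _ /int_spanP[m ->] /int_spanP[l ->]]; apply/int_spanP.
  by exists (fun=> 0%R); rewrite big1.
exists (fun i => m i - l i)%R.
apply: (@mulIg _ (\prod_(i < r) expgz (z i) (l i))).
rewrite mulgVK -prodgM_commute => [|i j _ _].
  by apply: eq_bigr => i _; rewrite expgzB mulgVK.
exact: expgz_commute.
Qed.

Lemma int_span_abelian : abelian_subgroup int_span.
Proof. by split=> [|g h _ /int_span_central]; first exact: int_span_group. Qed.

Lemma int_span_gen i : z i \in int_span.
Proof.
apply/int_spanP; exists (fun j => Posz (j == i)).
(* In a noncommutative group one factor of a product cannot be singled out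
   directly, so the single term is expanded to a product over all indices. *)
rewrite -[LHS](big_pred1_eq (@mul G) i z) big_mkcond /=.
by apply: eq_bigr => j _; case: eqP.
Qed.

Lemma int_span_expgz g k : g \in int_span -> expgz g k \in int_span.
Proof.
have [H1 _] := int_span_group; have HM := group_closedM int_span_group.
have HX n h : h \in int_span -> h ^+ n \in int_span.
  by move=> Hh; elim: n => // n IHn; rewrite expgS HM.
by case: k => n Hg /=; [|apply: (group_closedV int_span_group)]; apply: HX.
Qed.

(* The maps d_c are, up to the factor N, dual to the z_i. *)
Variables (d : 'I_r -> G -> int) (N : int).
Hypotheses (dM : forall c a b, d c (a * b) = (d c a + d c b)%R)
  (dz : forall c i, d c (z i) = (if i == c then N else 0)%R) (N0 : N != 0%R).

Lemma degree_int_span c (m : 'I_r -> int) :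
  d c (\prod_(i < r) expgz (z i) (m i)) = (m c * N)%R.
Proof.
rewrite degree_prod // (bigD1 c) //= dz eqxx big1 ?addr0 // => i /negPf ic.
by rewrite dz ic mulr0.
Qed.

(** A relation between the degree vectors of elements of the span is a relation
    between the elements themselves, because an element of the span all of whose
    degrees vanish is trivial. *)
Lemma int_span_rank : abelian_rank int_span r.
Proof.
split.
  exists z => [i|m m1 i]; first exact: int_span_gen.
  have := degree_int_span i m; rewrite m1 degree1 // => /esym/eqP.
  by rewrite mulf_eq0 (negPf N0) orbF => /eqP.
move=> n a aH a_ind; rewrite leqNgt; apply/negP => lt_rn.
have [k [i /eqP ki] kA] := int_dependence (fun i c => d c (a i)) lt_rn.
apply/ki/a_ind.
have /int_spanP[m mE] : \prod_(i < n) expgz (a i) (k i) \in int_span.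
  have [H1 _] := int_span_group; have HM := group_closedM int_span_group.
  by elim/big_ind: _ => // j _; apply: int_span_expgz.
rewrite mE big1 // => c _; suff -> : m c = 0%R by [].
have := degree_int_span c m; rewrite -mE degree_prod // kA => /esym/eqP.
by rewrite mulf_eq0 (negPf N0) orbF => /eqP.
Qed.

End Span.

(** * Groups generated by a finite set stable under conjugation *)

Section ConjStable.
Variables (X : finType) (G : groupType) (gen : X -> G).
Hypothesis gen_conj : forall x y, exists y', gen x * gen y = gen y' * gen x.
Hypothesis gen_all : forall g, exists w : word X, g = eval_word gen w.

Local Notation N := #|X|`!.

Lemma commute_gens g : (forall y, commute g (gen y)) -> forall h, commute g h.
Proof.
move=> cg h; have [w ->] := gen_all h; apply: commute_prod => -[x b] _ /=.
by case: b; rewrite //; apply: commuteV.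
Qed.

Lemma gen_conjX x n y : exists y', gen x ^+ n * gen y = gen y' * gen x ^+ n.
Proof.
elim: n => [|n [y' IHn]]; first by exists y; rewrite mulg1 mul1g.
have [y'' E] := gen_conj x y'; exists y''.
by rewrite !expgS -mulgA IHn !mulgA E.
Qed.

(** Among the conjugates of y by the powers x^i with 0 <= i <= |X|, two agree,
    so y commutes with x^j for some 0 < j <= |X|, and j divides |X|!. *)
Lemma gen_power_central x g : commute g (gen x ^+ N).
Proof.
apply: commute_sym; move: g; apply: commute_gens => y.
have /choice[c cP] n := gen_conjX x n y.
have [i [j [ij cij]]] : exists i j : 'I_#|X|.+1, (i < j)%N /\ c i = c j.
  have /injectivePn[i [j ij cij]] : ~~ injectiveb (fun i : 'I_#|X|.+1 => c i).
    by apply/negP => /injectiveP/leq_card; rewrite card_ord ltnn.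
  case: (ltngtP i j) => [lt|lt|/val_inj e]; last by rewrite e eqxx in ij.
    by exists i, j.
  by exists j, i.
have cji : commute (gen x ^+ (j - i)) (gen y).
  apply: (@mulgI _ (gen x ^+ i)); rewrite mulgA -expgnDr subnKC ?(ltnW ij) //.
  by rewrite cP -cij mulgA cP -mulgA -expgnDr subnKC ?(ltnW ij).
have /dvdnP[q ->] : (j - i %| N)%N.
  by rewrite dvdn_fact // subn_gt0 ij (leq_trans (leq_subr _ _)) // -ltnS.
by rewrite mulnC expgnA; apply/commute_sym/commuteX/commute_sym.
Qed.

(** Conjugation by x^-n also maps generators to generators: x^-n differs from
    the positive power x^((N - 1) n) by the central element x^(N n). *)
Lemma gen_pull x n y : exists y', gen y * gen x ^+ n = gen x ^+ n * gen y'.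
Proof.
have [y' E] := gen_conjX x (N.-1 * n) y; exists y'.
apply: (@mulgI _ (gen x ^+ (N.-1 * n))).
rewrite !mulgA -expgnDr -mulSnr prednK ?fact_gt0 //.
rewrite E -mulgA -expgnDr -mulSnr prednK ?fact_gt0 // expgnA.
exact/commuteX/gen_power_central.
Qed.

Local Notation prod_gen s := (\prod_(x <- s) gen x).

Lemma prod_gen_pull x n s : (n <= count_mem x s)%N ->
  exists2 t, size s = (n + size t)%N & prod_gen s = gen x ^+ n * prod_gen t.
Proof.
elim: s n => [|y s IHs] n /=.
  by rewrite leqn0 => /eqP ->; exists [::]; rewrite // mul1g.
have [->|yx] := eqVneq y x => /=; case: n => [|n].
- by move=> _; exists (x :: s); rewrite // mul1g.
- rewrite ltnS => /IHs[t st pt]; exists t; first by rewrite st.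
  by rewrite big_cons pt mulgA expgS.
- by move=> _; exists (y :: s); rewrite // mul1g.
move=> /IHs[t st pt]; have [y' E] := gen_pull x n.+1 y.
exists (y' :: t); first by rewrite st /= addnS.
by rewrite !big_cons pt !mulgA E.
Qed.

(** The coset representatives are the products of at most |X| (N - 1)
    generators: a longer product contains some generator N times, by the
    pigeonhole principle, and can be shortened modulo H. *)
Lemma finite_index_powers (H : {pred G}) :
  group_closed H -> (forall x, gen x ^+ N \in H) ->
  (forall g h, h \in H -> commute g h) -> finite_index H.
Proof.
move=> Hgr HN HC; have HM := group_closedM Hgr; have HV := group_closedV Hgr.
have [H1 _] := Hgr.
(* Inverses of generators are eliminated by x^-1 = x^-N x^(N-1). *)
have positive g : exists2 h, h \in H & exists s, g = h * prod_gen s.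
  have [w ->] := gen_all g; rewrite /eval_word.
  elim: w => [|[x b] w [h Hh [s IHw]]].
    by exists 1 => //; exists [::]; rewrite !big_nil mulg1.
  rewrite big_cons IHw mulgA (HC _ _ Hh) -mulgA; case: b => /=; last first.
    by exists h => //; exists (x :: s); rewrite big_cons.
  exists (h * (gen x ^+ N)^-1); first by rewrite HM ?HV.
  exists (nseq N.-1 x ++ s); rewrite big_cat big_nseq iter_mulg_1 /= -!mulgA.
  congr (_ * _); rewrite mulgA; congr (_ * _).
  by rewrite -[in RHS](prednK (fact_gt0 #|X|)) expgSr invgM mulgVK.
pose M := (#|X| * N.-1)%N.
have short n s : (size s <= n)%N -> exists2 h, h \in H
    & exists2 t, (size t <= M)%N & prod_gen s = h * prod_gen t.
  elim: n s => [|n IHn] s sn.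
    by exists 1 => //; exists s; rewrite ?mul1g // (leq_trans sn).
  have [sM|ltMs] := leqP (size s) M.
    by exists 1 => //; exists s; rewrite ?mul1g.
  have [x Nx] : exists x, (N <= count_mem x s)%N.
    apply/existsP; apply: contraLR ltMs => /existsPn few; rewrite -leqNgt.
    have -> : size s = (\sum_(x : X) count_mem x s)%N.
      elim: s {few sn} => [|y s IHs] /=; first by rewrite big1.
      rewrite big_split /= -IHs (bigD1 y) //= eqxx big1 // => x.
      by rewrite eq_sym => /negPf ->.
    rewrite /M -sum_nat_const; apply: leq_sum => x _.
    by rewrite -ltnS prednK ?fact_gt0 // ltnNge few.
  have [t st ->] := prod_gen_pull Nx.
  have [|h Hh [u su ->]] := IHn t.
    by rewrite -ltnS (leq_trans _ sn) // st -addn1 addnC leq_add2r fact_gt0.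
  by exists (gen x ^+ N * h); rewrite ?HM //; exists u; rewrite ?mulgA.
exists (codom (fun t : M.-bseq X => prod_gen t)) => g.
have [h Hh [s ->]] := positive g.
have [h' Hh' [t st ->]] := short _ s (leqnn _).
exists (prod_gen t); first exact: (codom_f _ (Bseq st)).
by rewrite [h * _]mulgA -(HC _ _ (HM _ _ Hh Hh')) mulKg HM.
Qed.

End ConjStable.

(** * The derived structure group *)

Section DerivedGroup.
Variables (X : finType) (S : X * X -> X * X).
Hypothesis S_nondeg : nondegenerate S.

Local Notation G := (derived_group S).
Local Notation gen := (pres_gen (derived_relation S) : X -> G).

Lemma derived_gen_conj x y : gen x * gen y = gen (br_phi S y x) * gen x.
Proof.
rewrite -!pres_classM; apply/pres_classP/pres_rel.
by apply/(derived_relation_phi _ _ S_nondeg); exists x, y.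
Qed.

Lemma derived_gen_all (g : G) : exists w : word X, g = eval_word gen w.
Proof.
exists (repr g); rewrite -[LHS]pres_class_repr.
elim: (repr g) => [|[x b] w IHw]; first by rewrite /eval_word big_nil.
have genV : (gen x)^-1 = pres_class _ [:: (x, true)] by exact: pres_invE.
rewrite -cat1s pres_classM IHw /eval_word big_cat big_seq1 /=.
by case: b; rewrite ?genV.
Qed.

(** Equality of the n-th powers is an equivalence relation on X, and it relates
    y to phi(y, x), as conjugation by x fixes the central element y^n. *)
Lemma phi_equiv_power n :
  (forall x (g : G), commute g (gen x ^+ n)) ->
  forall x y, phi_equiv S x y -> gen x ^+ n = gen y ^+ n.
Proof.
move=> central x y /asboolP/(_ (fun u v => gen u ^+ n == gen v ^+ n)) h.
apply/eqP/h => [u v w|u v]; first by split=> // /eqP ->.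
have E : gen (br_phi S v u) = gen v ^ (gen u)^-1.
  by rewrite /conjg invgK mulgA derived_gen_conj mulgK.
by rewrite E -conjXg /conjg invgK mulgA central mulgK.
Qed.

Definition word_degree (P : pred X) (w : word X) : int :=
  (\sum_(l <- w | P l.1) (-1) ^+ l.2)%R.

Lemma word_degree_cat P u v :
  word_degree P (u ++ v) = (word_degree P u + word_degree P v)%R.
Proof. exact: big_cat. Qed.

(** A defining relation replaces the letter y by phi(y, x), which lies in P
    exactly when y does. *)
Lemma word_degree_pres (P : pred X) : (forall x y, P (br_phi S y x) = P y) ->
  forall u v, pres_eq (derived_relation S) u v ->
    word_degree P u = word_degree P v.
Proof.
move=> Pphi u v; elim=> {u v} //=.
- by move=> u v w _ -> _ ->.
- by move=> u u' v v' _ Eu _ Ev; rewrite !word_degree_cat Eu Ev.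
- case=> x b; rewrite /word_degree !big_cons big_nil /=.
  by case: (P x); case: b.
move=> u v /(derived_relation_phi _ _ S_nondeg)[x [y [-> ->]]].
rewrite /word_degree !big_cons big_nil /= Pphi.
by case: (P x); case: (P y).
Qed.

Definition degree (P : pred X) (g : G) : int := word_degree P (repr g).

Lemma degree_class (P : pred X) w : (forall x y, P (br_phi S y x) = P y) ->
  degree P (pres_class _ w) = word_degree P w.
Proof. by move=> /word_degree_pres; apply; apply: repr_pres_class. Qed.

Lemma degreeM (P : pred X) : (forall x y, P (br_phi S y x) = P y) ->
  forall a b, degree P (a * b) = (degree P a + degree P b)%R.
Proof.
move=> Pphi a b; rewrite -[a]pres_class_repr -[b]pres_class_repr.
by rewrite -pres_classM !degree_class // word_degree_cat.
Qed.

Lemma degree_gen (P : pred X) x : (forall x y, P (br_phi S y x) = P y) ->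
  degree P (gen x) = Posz (P x).
Proof.
move=> Pphi; rewrite degree_class // /word_degree big_cons big_nil /=.
by case: (P x).
Qed.

Lemma phi_equiv_phi x y : phi_equiv S y (br_phi S y x).
Proof. by apply/asboolP => E _; apply. Qed.

Lemma derived_group_rank :
  group_rank G #|equivalence_partition (phi_equiv S) [set: X]|.
Proof.
set P := equivalence_partition _ _.
have eqv : {in [set: X] & &, equivalence_rel (phi_equiv S)}.
  by move=> x y z _ _ _; apply: phi_equiv_equivalence.
have partP : partition P [set: X] := equivalence_partitionP eqv.
have [/eqP covP trivP nP] := and3P partP.
have pblockE x y : (pblock P x == pblock P y) = phi_equiv S x y.
  rewrite eq_pblock ?covP ?inE // /P.
  by rewrite pblock_equivalence_partition ?inE.
have repP (i : 'I_#|P|) : exists x, enum_val i == pblock P x.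
  have Pi := enum_valP i.
  have /set0Pn[x xi] : enum_val i != set0 by apply: contraNneq nP => <-.
  by exists x; rewrite (def_pblock trivP Pi xi).
pose rep i := xchoose (repP i); have repE i := eqP (xchooseP (repP i)).
pose cls (i : 'I_#|P|) : pred X := fun x => pblock P x == enum_val i.
have clsphi i x y : cls i (br_phi S y x) = cls i y.
  have /eqP E : pblock P y == pblock P (br_phi S y x).
    by rewrite pblockE phi_equiv_phi.
  by rewrite /cls E.
have conj x y : exists y', gen x * gen y = gen y' * gen x.
  by exists (br_phi S y x); apply: derived_gen_conj.
have central := gen_power_central conj derived_gen_all.
pose z i := gen (rep i) ^+ #|X|`!.
have zC i g : commute g (z i) by apply: central.
exists (int_span z); split; first exact: int_span_abelian.
  apply: (finite_index_powers conj derived_gen_all) => [|x|g h].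
  - exact: int_span_group.
  - have xP : pblock P x \in P by rewrite pblock_mem ?covP.
    rewrite (phi_equiv_power central (y := rep (enum_rank_in xP (pblock P x)))).
      exact: int_span_gen.
    by rewrite -pblockE -repE enum_rankK_in.
  - exact: int_span_central.
apply: (int_span_rank zC (d := fun i => degree (cls i)) (N := (Posz #|X|`!))).
- by move=> c; apply: degreeM.
- move=> c i.
  have := degree_expgz (degreeM (clsphi c)) (gen (rep i)) (Posz #|X|`!).
  rewrite degree_gen // /cls -repE (inj_eq enum_val_inj) => ->.
  by case: eqP; rewrite ?mulr1 ?mulr0.
- by rewrite -lt0n fact_gt0.
Qed.

End DerivedGroup.

Theorem theorem2p10 (X : finType) (S : X * X -> X * X)
    (X_nonempty : (0 < #|X|)%N) (S_bij : bijective S)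
    (S_braided : braided S) (S_nondeg : nondegenerate S) :
  group_rank (derived_group S)
    #|equivalence_partition (phi_equiv S) [set: X]|.
Proof. exact: derived_group_rank. Qed.
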